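(* Let $\lambda \in \Lambda := \{\lambda \in \mathbb{R}^n : \lambda_i \ge 0 \ \forall i,\ \lambda \neq 0,\ \sum_{i=1}^n \lambda_i = 1\}$. If $x \in \mathcal{X}$ is strictly weighted sum MARO-efficient for $\lambda$, then $x$ is strictly multi-scenario MARO-efficient with respect to the preorder $\leqq^{\lambda,\min}$.
   Context: Setting (multicriteria adjustable robust optimization, MARO): $\mathcal{X} \subset \mathbb{R}^{n_x}$ and $\mathcal{U} \subset \mathbb{R}^{n_u}$ are compact sets; for each $x \in \mathcal{X}$, $u \in \mathcal{U}$, $\mathcal{Y}(x,u) \subset \mathbb{R}^{n_y}$ is a compact set; $f = (f_1,\dots,f_n)^T$ with each $f_i(x,u,y)$ a continuous real-valued function. The formal problem is $\min_{x \in \mathcal{X}} \max_{u \in \mathcal{U}} \min_{y \in \mathcal{Y}(x,u)} f(x,u,y)$. Here $\max$ and $\min$ of real-valued expressions denote optimal values (in the extended reals); minimization over an empty set has value $+\infty$ and maximization over an empty set has value $-\infty$. Efficient set of the inner stage: for vectors $a,b\in\mathbb{R}^n$ write $a \le b$ if $a_i \le b_i$ for all $i$ and $a \ne b$. For fixed $x,u$, $$\mathcal{Y}(x,u)_E := \{ y \in \mathcal{Y}(x,u) : \nexists\, y' \in \mathcal{Y}(x,u) \text{ with } f(x,u,y') \le f(x,u,y)\},$$ and $f(x,u,\mathcal{Y}(x,u)_E) := \{f(x,u,y) : y \in \mathcal{Y}(x,u)_E\} \subset \mathbb{R}^n$. Set relation: for $A,B \subset \mathbb{R}^n$, $A \leqq^{\lambda,\min}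 B$ means $\min_{a \in A} \lambda^T a \le \min_{b \in B} \lambda^T b$. Strict multi-scenario MARO-efficiency with respect to a set relation $\leqq^*$: $x \in \mathcal{X}$ has this property if there is no $x' \in \mathcal{X} \setminus \{x\}$ such that $f(x',u,\mathcal{Y}(x',u)_E) \leqq^* f(x,u,\mathcal{Y}(x,u)_E)$ for all $u \in \mathcal{U}$. Strict weighted sum MARO-efficiency: let $f_\lambda(x) := \max_{u \in \mathcal{U}} \min_{y \in \mathcal{Y}(x,u)} \sum_{i=1}^n \lambda_i f_i(x,u,y)$. A point $x \in \mathcal{X}$ is strictly weighted sum MARO-efficient for $\lambda$ if there is no $x' \in \mathcal{X} \setminus \{x\}$ with $f_\lambda(x') \le f_\lambda(x)$. *)

(* Defs.v *)
From mathcomp Require Import all_boot all_order all_algebra.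
From mathcomp Require Import all_classical all_reals all_analysis.

Set Implicit Arguments.
Unset Strict Implicit.
Unset Printing Implicit Defensive.

Import Order.TTheory GRing.Theory Num.Theory.
Import numFieldNormedType.Exports.

Local Open Scope classical_set_scope.
Local Open Scope ring_scope.

Definition vdominates (R : realType) (n : nat) (a b : 'cV[R]_n) : Prop :=
  (forall i, a i 0 <= b i 0) /\ a <> b.

Definition wsum (R : realType) (n : nat) (lambda a : 'cV[R]_n) : R :=
  \sum_(i < n) lambda i 0 * a i 0.

Definition weights (R : realType) (n : nat) : set 'cV[R]_n :=
  [set lambda | [/\ forall i, 0 <= lambda i 0, lambda <> 0
                  & \sum_(i < n) lambda i 0 = 1]].

(** [lambda_min_le lambda] is the set relation written A ≦^{λ,min} B.
    Optimal values are taken in [\bar R] with [ereal_inf] and [ereal_sup], so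
    that attainment is not presupposed, [ereal_inf set0 = +oo] and
    [ereal_sup set0 = -oo]. *)
Definition lambda_min_le (R : realType) (n : nat) (lambda : 'cV[R]_n)
    (A B : set 'cV[R]_n) : Prop :=
  (ereal_inf [set (wsum lambda a)%:E | a in A]
   <= ereal_inf [set (wsum lambda b)%:E | b in B])%E.

Definition inner_efficient (R : realType) (nx nu ny n : nat)
    (Y : 'cV[R]_nx -> 'cV[R]_nu -> set 'cV[R]_ny)
    (f : 'cV[R]_nx -> 'cV[R]_nu -> 'cV[R]_ny -> 'cV[R]_n)
    (x : 'cV[R]_nx) (u : 'cV[R]_nu) : set 'cV[R]_ny :=
  [set y | Y x u y /\ ~ exists2 y', Y x u y' & vdominates (f x u y') (f x u y)].

Definition strictly_multi_scenario_efficient (R : realType) (nx nu ny n : nat)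
    (srel : set 'cV[R]_n -> set 'cV[R]_n -> Prop)
    (X : set 'cV[R]_nx) (U : set 'cV[R]_nu)
    (Y : 'cV[R]_nx -> 'cV[R]_nu -> set 'cV[R]_ny)
    (f : 'cV[R]_nx -> 'cV[R]_nu -> 'cV[R]_ny -> 'cV[R]_n)
    (x : 'cV[R]_nx) : Prop :=
  X x /\
  ~ exists2 x', (X `\ x) x'
      & forall u, U u ->
          srel (f x' u @` inner_efficient Y f x' u)
               (f x u @` inner_efficient Y f x u).

Definition weighted_sum_value (R : realType) (nx nu ny n : nat)
    (lambda : 'cV[R]_n) (U : set 'cV[R]_nu)
    (Y : 'cV[R]_nx -> 'cV[R]_nu -> set 'cV[R]_ny)
    (f : 'cV[R]_nx -> 'cV[R]_nu -> 'cV[R]_ny -> 'cV[R]_n)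
    (x : 'cV[R]_nx) : \bar R :=
  ereal_sup [set ereal_inf [set (wsum lambda (f x u y))%:E | y in Y x u]
            | u in U].

Definition strictly_weighted_sum_efficient (R : realType) (nx nu ny n : nat)
    (lambda : 'cV[R]_n) (X : set 'cV[R]_nx) (U : set 'cV[R]_nu)
    (Y : 'cV[R]_nx -> 'cV[R]_nu -> set 'cV[R]_ny)
    (f : 'cV[R]_nx -> 'cV[R]_nu -> 'cV[R]_ny -> 'cV[R]_n)
    (x : 'cV[R]_nx) : Prop :=
  X x /\
  ~ exists2 x', (X `\ x) x'
      & (weighted_sum_value lambda U Y f x'
         <= weighted_sum_value lambda U Y f x)%E.

Definition feasible (R : realType) (nx nu ny : nat)
    (X : set 'cV[R]_nx) (U : set 'cV[R]_nu)
    (Y : 'cV[R]_nx -> 'cV[R]_nu -> set 'cV[R]_ny) :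
    set ('cV[R]_nx * 'cV[R]_nu * 'cV[R]_ny) :=
  [set z | [/\ X z.1.1, U z.1.2 & Y z.1.1 z.1.2 z.2]].

(* Main.v *)
Require Import Defs.
From mathcomp Require Import all_boot all_order all_algebra.
From mathcomp Require Import all_classical all_reals all_analysis.

Set Implicit Arguments.
Unset Strict Implicit.
Unset Printing Implicit Defensive.

Import Order.TTheory GRing.Theory Num.Theory.
Import numFieldNormedType.Exports.

Local Open Scope classical_set_scope.
Local Open Scope ring_scope.

(** The set relation compares minima of [lambda^T f] over the efficient sets
    [Y(x, u)_E], while [f_lambda] takes its inner minimum over all of
    [Y(x, u)].  These two minima agree: [Y(x, u)_E] is a subset of [Y(x, u)],
    and conversely every objective vector is bounded below, componentwise, by
    an efficient one, which does at least as well under nonnegative weights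
    ([ereal_inf_inner_efficient]).  Such an efficient vector exists because
    the set of objective vectors [f(x, u, Y(x, u))] is compact
    ([compact_externally_stable]).

    Hence an [x'] that beats [x] for the set relation in every scenario [u]
    has inner minima no larger than those of [x] for every [u]; passing to the
    supremum over [u] gives [f_lambda(x') <= f_lambda(x)], which strict
    weighted sum efficiency of [x] rules out. *)

Lemma cvg_mx_coord (T : topologicalType) (S : Type) (F : set_system S)
    (FF : Filter F) (m n : nat) (g : S -> 'M[T]_(m, n)) (M : 'M[T]_(m, n)) :
  (forall i j, g s i j @[s --> F] --> M i j) -> g s @[s --> F] --> M.
Proof.
move=> gM A [P MP PA].
have : \forall s \near F, forall i j, P i j (g s i j); last first.
  by apply: filterS => s Ps; exact: PA.
apply: filter_forall => i; apply: filter_forall => j.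
exact: gM (MP i j).
Qed.

(** A minimizer of the sum of the entries among the points of [Z] below [b]
    is nondominated: a point of [Z] dominating it would still lie below [b]
    and have a strictly smaller sum. *)
Lemma compact_externally_stable (R : realType) (n : nat) (Z : set 'cV[R]_n)
    (b : 'cV[R]_n) :
  compact Z -> Z b ->
  exists2 a, Z a & (forall i, a i 0 <= b i 0) /\
                   ~ exists2 c, Z c & vdominates c a.
Proof.
move=> Zcompact Zb.
pose below := \bigcap_(i in [set: 'I_n]) [set c : 'cV[R]_n | c i 0 <= b i 0].
have below_closed : closed below.
  apply: closed_bigI => i _.
  apply: (@preimage_closed _ _ (fun c : 'cV[R]_n => c i 0) [set r | r <= b i 0]).
    by move=> c _; exact: coord_continuous.
  exact: closed_le.
pose total (c : 'cV[R]_n) := \sum_i c i 0.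
have total_continuous : {within Z `&` below, continuous total}.
  apply: continuous_subspaceT => c; rewrite /total.
  apply: (@cvg_big _ _ _ _ _ (@add_continuous R) _ _ _ _ _ (nbhs_filter c)).
  by move=> i _; exact: coord_continuous.
have [||a] := @compact_EVT_min _ R total (Z `&` below) _ _ total_continuous.
- by exists b; split=> // i _ /=.
- exact: compact_closedI.
rewrite inE => -[Za a_below] a_min; exists a => //; split=> [i|].
  exact: a_below.
move=> [c Zc [c_le_a c_neq_a]]; apply: c_neq_a.
have /a_min : c \in Z `&` below.
  by rewrite inE; split=> // i _ /=; exact: le_trans (c_le_a i) (a_below i I).
rewrite -subr_le0 /total -sumrB => sum_le0.
have diff_ge0 i : true -> 0 <= a i 0 - c i 0 by rewrite subr_ge0 c_le_a.
have /eqP sum_eq0 : \sum_i (a i 0 - c i 0) == 0.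
  by rewrite eq_le sum_le0 sumr_ge0.
apply/matrixP => i j; rewrite (ord1 j); apply/esym/eqP.
by rewrite -subr_eq0; apply/eqP; exact: (psumr_eq0P diff_ge0 sum_eq0).
Qed.

Lemma wsum_le (R : realType) (n : nat) (lambda a b : 'cV[R]_n) :
  (forall i, 0 <= lambda i 0) -> (forall i, a i 0 <= b i 0) ->
  wsum lambda a <= wsum lambda b.
Proof. by move=> lambda_ge0 ab; apply: ler_sum => i _; exact: ler_wpM2l. Qed.

Section InnerStage.
Variables (R : realType) (nx nu ny n : nat).
Variables (Y : 'cV[R]_nx -> 'cV[R]_nu -> set 'cV[R]_ny).
Variables (f : 'cV[R]_nx -> 'cV[R]_nu -> 'cV[R]_ny -> 'cV[R]_n).

Lemma compact_objective_image (X : set 'cV[R]_nx) (U : set 'cV[R]_nu) x u :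
  (forall i : 'I_n,
    {within feasible X U Y,
      continuous (fun z : 'cV[R]_nx * 'cV[R]_nu * 'cV[R]_ny =>
                    f z.1.1 z.1.2 z.2 i 0)}) ->
  X x -> U u -> compact (Y x u) -> compact (f x u @` Y x u).
Proof.
move=> fcont Xx Uu; apply: continuous_compact.
apply/subspace_continuousP => y Yy; apply: cvg_mx_coord => i j.
rewrite (ord1 j).
move/subspace_continuousP: (fcont i) => /(_ (x, u, y)) fi_cvg.
(* The section [y' |-> (x, u, y')] carries [Y x u] into the feasible set. *)
apply: (@cvg_comp _ _ _ (fun y' => (x, u, y'))
  (fun z => f z.1.1 z.1.2 z.2 i 0) _
  (within (feasible X U Y) (nbhs (x, u, y)))); last exact: fi_cvg.
move=> A /= [/= [B C] [B_nbhs C_nbhs] BCA].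
apply: filterS C_nbhs => y' Cy' Yy'.
by apply: (BCA (x, u, y')) => //; split=> //; exact: nbhs_singleton.
Qed.

(** External stability puts an efficient objective vector below every
    feasible one, and nonnegative weights are monotone.  Working with infima
    in the extended reals also covers an empty [Y x u]: both sides are then
    [+oo]. *)
Lemma ereal_inf_inner_efficient (lambda : 'cV[R]_n) x u :
  (forall i, 0 <= lambda i 0) -> compact (f x u @` Y x u) ->
  ereal_inf [set (wsum lambda a)%:E | a in f x u @` inner_efficient Y f x u] =
  ereal_inf [set (wsum lambda (f x u y))%:E | y in Y x u].
Proof.
move=> lambda_ge0 Zcompact; apply/eqP; rewrite eq_le; apply/andP; split.
  apply: le_ereal_inf_tmp => _ [y Yy <-].
  have [_ [y' Yy' <-] [y'_le nondom]] :=
    compact_externally_stable Zcompact (imageP (f x u) Yy).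
  apply: (@le_trans _ _ (wsum lambda (f x u y'))%:E); last first.
    by rewrite lee_fin wsum_le.
  apply: ereal_inf_lbound.
  exists (f x u y') => //; exists y' => //; split=> // -[y'' Yy'' dom].
  by apply: nondom; exists (f x u y'') => //; exists y''.
by apply: ereal_inf_le_tmp => _ [_ [y [Yy _] <-] <-]; exists y.
Qed.

End InnerStage.

Theorem theorem15 (R : realType) (nx nu ny n : nat)
    (X : set 'cV[R]_nx) (U : set 'cV[R]_nu)
    (Y : 'cV[R]_nx -> 'cV[R]_nu -> set 'cV[R]_ny)
    (f : 'cV[R]_nx -> 'cV[R]_nu -> 'cV[R]_ny -> 'cV[R]_n)
    (X_compact : compact X) (U_compact : compact U)
    (Y_compact : forall x u, X x -> U u -> compact (Y x u))
    (f_continuous : forall i : 'I_n,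
      {within feasible X U Y,
        continuous (fun z : 'cV[R]_nx * 'cV[R]_nu * 'cV[R]_ny =>
                      f z.1.1 z.1.2 z.2 i 0)})
    (lambda : 'cV[R]_n) (lambda_weights : weights lambda)
    (x : 'cV[R]_nx) (x_in_X : X x)
    (x_efficient : strictly_weighted_sum_efficient lambda X U Y f x) :
  strictly_multi_scenario_efficient (lambda_min_le lambda) X U Y f x.
Proof.
case: lambda_weights => lambda_ge0 _ _.
case: x_efficient => _ x_unbeaten; split=> // -[x' Xx' x'_le_x].
have image_compact z u : X z -> U u -> compact (f z u @` Y z u).
  by move=> Xz Uu; apply: compact_objective_image => //; exact: Y_compact.
apply: x_unbeaten; exists x' => //.
apply: ge_ereal_sup => _ [u Uu <-].
have := x'_le_x u Uu; rewrite /lambda_min_le.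
rewrite !ereal_inf_inner_efficient//; [|exact: image_compact..|].
  by move=> /le_trans; apply; apply: ereal_sup_ubound; exists u.
by apply: image_compact => //; exact: Xx'.1.
Qed.
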